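(* Let $N\ge 2$ and let $X(t)=(X_1(t),\dots,X_N(t))$, $t\ge 0$, be the queue-length process of a system of $N$ parallel queues with infinite buffers, modelled as a continuous-time Markov process on $\mathbb{Z}_+^N$ as follows. Packets arrive at queue $i$ according to a Poisson process of rate $\lambda_i>0$ (independently across queues), and when the system is in state $x=(x_1,\dots,x_N)$, a nonempty queue $i$ (i.e. $x_i>0$) releases a packet at a state-dependent rate $\mu_i(x)$, where the functions $\mu_i:\mathbb{Z}_+^N\to[0,\infty)$ are bounded. Assume the system is homogeneous: $\lambda_1=\dots=\lambda_N$, and the service rates are invariant under permutations of the queues (i.e. $\mu_{\pi(i)}(x_{\pi^{-1}(1)},\dots,x_{\pi^{-1}(N)})=\mu_i(x)$ for every permutation $\pi$ of $\{1,\dots,N\}$). Suppose that there exists an index $i$ such that $$\lambda_i>\limsup_{x_i\to\infty}\ \sup_{x_j:\,j\neq i}\ \mu_i(x).$$ Then, for every initial state $X(0)\in\mathbb{Z}_+^N$, the process is eventually saturated: $\min_{1\le i\le N} X_i(t)>0$ for all sufficiently large $t$ (almost surely), i.e. in the long run every queue has at least one packet pending for transmission.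
   Context: Interpretation: $X_i(t)$ is the number of packets waiting at station $i$ at time $t$ in a random access network; the service rate of a queue may depend on the whole state (e.g. on how many queues are simultaneously nonempty), modelling the coupling between stations contending for a shared channel. The supremum $\sup_{x_j:\,j\neq i}\mu_i(x)$ is taken over all values of the coordinates $x_j$, $j\ne i$, with $x_i$ fixed, and the $\limsup$ is then taken as $x_i\to\infty$. *)

(* Defs.v *)
From HB Require Import structures.
From mathcomp Require Import all_boot all_order all_algebra all_fingroup.
From mathcomp Require Import all_classical all_reals all_analysis.
Set Implicit Arguments. Unset Strict Implicit. Unset Printing Implicit Defensive.
Import Order.TTheory GRing.Theory Num.Theory.
Local Open Scope classical_set_scope.
Local Open Scope ring_scope.

Definition state (N : nat) := {ffun 'I_N -> nat}.

Definition incr N (x : state N) (i : 'I_N) : state N := [ffun j => (x j + (j == i))%N].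
Definition decr N (x : state N) (i : 'I_N) : state N := [ffun j => (x j - (j == i))%N].

Definition permst N (pi : 'S_N) (x : state N) : state N := [ffun j => x ((pi^-1)%g j)].

Section Rates.
Context {R : realType} {N : nat} (lam : 'I_N -> R) (mu : 'I_N -> state N -> R).

Definition rate (x y : state N) : R :=
  \sum_(i < N) (((y == incr x i)%:R * lam i) +
                (((0 < x i)%N && (y == decr x i))%:R * mu i x)).

Definition qout (x : state N) : R :=
  \sum_(i < N) (lam i + ((0 < x i)%N)%:R * mu i x).

Definition jump (x y : state N) : R := rate x y / qout x.
End Rates.

(* Jump-hold description of a CTMC: Y n = state after the n-th jump,
   S n = holding time in Y n.  jtime S n = time of the n-th jump. *)
Definition jtime {R : realType} (S : nat -> R) (n : nat) : R := \sum_(k < n) S k.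

Definition state_at {R : realType} {N : nat} (Y : nat -> state N) (S : nat -> R)
    (t : R) (x : state N) : Prop :=
  exists n, jtime S n <= t /\ t < jtime S n.+1 /\ Y n = x.

Definition eventually_saturated {R : realType} {N : nat}
    (Y : nat -> state N) (S : nat -> R) : Prop :=
  exists t0 : R, forall t, t0 <= t ->
    exists x, state_at Y S t x /\ forall i : 'I_N, (0 < x i)%N.

Definition cyl {T : Type} {R : realType} {N : nat}
    (Y : T -> nat -> state N) (S : T -> nat -> R) (n : nat)
    (ys : nat -> state N) (ss : nat -> R) : set T :=
  [set w | forall k, (k <= n)%N -> Y w k = ys k /\ ss k < S w k].

(* (Y,S) is (the jump-hold construction of) the CTMC with rates lam, mu,
   started at x0: its finite-dimensional law is that of the jump chain with
   transition matrix jump and independent Exp(qout (Y k)) holding times. *)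
Definition is_queue_ctmc {d} {T : measurableType d} {R : realType} {N : nat}
    (P : probability T R) (lam : 'I_N -> R) (mu : 'I_N -> state N -> R)
    (x0 : state N) (Y : T -> nat -> state N) (S : T -> nat -> R) : Prop :=
  forall (n : nat) (ys : nat -> state N) (ss : nat -> R),
    (forall k, 0 <= ss k) ->
    measurable (cyl Y S n ys ss) /\
    P (cyl Y S n ys ss) =
      ((ys 0%N == x0)%:R
        * (\prod_(k < n) jump lam mu (ys k) (ys k.+1))
        * (\prod_(k < n.+1) expR (- (qout lam mu (ys k) * ss k))))%:E.

(* Main.v *)
(** The argument runs on the jump chain, one queue at a time.  By symmetry the
    drift hypothesis holds for every queue, so above some level [K] queue [i] is
    served at rate at most [r < lam i], and below it at a bounded rate.  Hence
    some bounded nonnegative function [f] of [x i] alone is superharmonic for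
    the jump chain and decreases on average by a fixed [c > 0] from every state
    with [x i = 0].  Summing over the steps, the expected number of visits to
    [x i = 0] is at most [f / c], and Borel-Cantelli makes the visits finite in
    number.  It remains to exclude explosion: the total jump rate is at most
    some [Q], so [n] consecutive holding times are all at most 1 with
    probability at most [(1 - exp (- Q)) ^ n], and infinitely many of them
    exceed 1 almost surely. *)

Require Import Defs.
From HB Require Import structures.
From mathcomp Require Import all_boot all_order all_algebra all_fingroup.
From mathcomp Require Import all_classical all_reals all_analysis.
Import Order.TTheory GRing.Theory Num.Theory.
Local Open Scope classical_set_scope.
Local Open Scope ring_scope.

Set Implicit Arguments.
Unset Strict Implicit.
Unset Printing Implicit Defensive.

(** * Expectations along the finite path tree of a Markov chain *)

Section PathTree.
Context {R : realType} {V : choiceType} (next : V -> seq V) (p : V -> V -> R)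
  (x0 : V).

Fixpoint paths (n : nat) : seq (seq V) :=
  if n is m.+1 then
    [seq rcons l y | l <- paths m, y <- next (nth x0 l m)]
  else [:: [:: x0]].

Definition path_weight (n : nat) (l : seq V) : R :=
  \prod_(k < n) p (nth x0 l k) (nth x0 l k.+1).

(** For stochastic [p] supported on [next], this is the expectation of [g] after [n] steps from
    [x0], as a finite sum without integrals. *)
Definition path_mean (n : nat) (g : V -> R) : R :=
  \sum_(l <- paths n) path_weight n l * g (nth x0 l n).

Lemma size_paths n l : l \in paths n -> size l = n.+1.
Proof.
elim: n l => [|n IHn] l /=; first by rewrite inE => /eqP ->.
by case/allpairsPdep => l' [y [l'n _ ->]]; rewrite size_rcons IHn.
Qed.

Lemma nth0_paths n l : l \in paths n -> nth x0 l 0 = x0.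
Proof.
elim: n l => [|n IHn] l /=; first by rewrite inE => /eqP ->.
case/allpairsPdep => l' [y [l'n _ ->]].
by rewrite nth_rcons (size_paths l'n) /= IHn.
Qed.

Lemma uniq_paths n : (forall x, uniq (next x)) -> uniq (paths n).
Proof.
move=> next_uniq; elim: n => [//|n IHn] /=.
apply: allpairs_uniq_dep => // -[l y] [l' y'] _ _ /= /rcons_inj[-> ->] //.
Qed.

Lemma path_weight_ge0 n l : (forall x y, 0 <= p x y) -> 0 <= path_weight n l.
Proof. by move=> p_ge0; apply: prodr_ge0. Qed.

Lemma path_mean0 g : path_mean 0 g = g x0.
Proof. by rewrite /path_mean big_seq1 /path_weight big_ord0 mul1r. Qed.

(** The Markov property: condition on the first [n] steps and average over the last one. *)
Lemma path_meanS n g :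
  path_mean n.+1 g = path_mean n (fun x => \sum_(y <- next x) p x y * g y).
Proof.
rewrite /path_mean /= big_allpairs_dep /=.
apply: eq_big_seq => l ln; rewrite mulr_sumr; apply: eq_bigr => y _.
rewrite mulrA; congr (_ * _); last by rewrite nth_rcons (size_paths ln) ltnn eqxx.
rewrite /path_weight big_ord_recr /= !nth_rcons (size_paths ln) ltnS leqnn.
rewrite ltnn eqxx; congr (_ * _); apply: eq_bigr => k _.
by rewrite !nth_rcons (size_paths ln) !ltnS ltn_ord ltnW.
Qed.

Lemma ler_path_mean n g h : (forall x y, 0 <= p x y) ->
  (forall x, g x <= h x) -> path_mean n g <= path_mean n h.
Proof.
move=> p_ge0 gh; apply: ler_sum => l _.
by rewrite ler_wpM2l// path_weight_ge0.
Qed.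

Lemma path_mean1 n : (forall x, \sum_(y <- next x) p x y = 1) ->
  path_mean n (fun=> 1) = 1.
Proof.
move=> p1; elim: n => [|n IHn]; first by rewrite path_mean0.
rewrite path_meanS -[RHS]IHn; congr path_mean; apply/funext => x.
by rewrite -[RHS](p1 x); apply: eq_bigr => y _; rewrite mulr1.
Qed.

Lemma occupation_bound (f a : V -> R) (c : R) n :
  (forall x y, 0 <= p x y) -> (forall x, 0 <= f x) ->
  (forall x, \sum_(y <- next x) p x y * f y <= f x - c * a x) ->
  c * \sum_(k < n) path_mean k a <= f x0.
Proof.
move=> p_ge0 f_ge0 drift.
(* Keeping the remaining mean of [f] makes the induction telescope: each step pays for its own visit
   term. *)
suff : c * \sum_(k < n) path_mean k a + path_mean n f <= f x0.
  apply: le_trans; rewrite lerDl; apply: sumr_ge0 => l _.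
  by rewrite mulr_ge0// path_weight_ge0.
elim: n => [|n IHn]; first by rewrite big_ord0 mulr0 add0r path_mean0.
rewrite big_ord_recr /= mulrDr -addrA; apply: le_trans IHn.
rewrite lerD2l path_meanS -lerBrDl.
apply: le_trans (ler_path_mean n p_ge0 drift) _.
rewrite /path_mean mulr_sumr -sumrB ler_sum// => l _.
by rewrite mulrBr mulrCA.
Qed.
End PathTree.

(** * The jump chain and its Lyapunov function *)

Lemma big_seq_delta (R : pzRingType) (I : eqType) (s : seq I) (a : I) (c : R)
    (g : I -> R) : uniq s -> a \in s ->
  \sum_(y <- s) (y == a)%:R * c * g y = c * g a.
Proof.
move=> s_uniq a_s; rewrite (bigD1_seq a)//= eqxx mul1r big1 ?addr0// => y /negPf ->.
by rewrite !mul0r.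
Qed.

Section QueueJump.
Context {R : realType} {N : nat} (lam : 'I_N -> R) (mu : 'I_N -> state N -> R).

(** [decr] fixes [x] at each empty queue, so entries may repeat; [undup] prevents double counting,
    and the entry [x] itself has jump rate zero. *)
Definition neighbours (x : state N) : seq (state N) :=
  undup (map (incr x) (enum 'I_N) ++ map (decr x) (enum 'I_N)).

Lemma neighbours_uniq x : uniq (neighbours x).
Proof. exact: undup_uniq. Qed.

Lemma sum_jump x (g : state N -> R) :
  \sum_(y <- neighbours x) jump lam mu x y * g y =
  (\sum_(i < N) (lam i * g (incr x i) +
                 (0 < x i)%N%:R * mu i x * g (decr x i))) / qout lam mu x.
Proof.
rewrite mulr_suml.
under eq_bigr do rewrite /jump /rate mulrAC mulr_suml mulr_suml.
rewrite exchange_big; apply: eq_bigr => i _ /=; rewrite -mulr_suml.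
congr (_ / _); under eq_bigr do rewrite mulrDl.
have incr_nb : incr x i \in neighbours x.
  by rewrite mem_undup mem_cat map_f// mem_enum.
have decr_nb : decr x i \in neighbours x.
  by rewrite mem_undup mem_cat orbC map_f// mem_enum.
rewrite big_split /= big_seq_delta ?neighbours_uniq//; congr (_ + _).
rewrite -(@big_seq_delta _ _ (neighbours x) (decr x i)) ?neighbours_uniq//.
by apply: eq_bigr => y _; rewrite -mulnb natrM mulrCA !mulrA.
Qed.

Hypotheses (N_gt0 : (0 < N)%N) (lam_gt0 : forall i, 0 < lam i)
  (mu_ge0 : forall i x, 0 <= mu i x).

Lemma qout_gt0 x : 0 < qout lam mu x.
Proof.
apply: (@lt_le_trans _ _ (lam (Ordinal N_gt0))) => //.
rewrite /qout (bigD1 (Ordinal N_gt0)) //= -addrA lerDl addr_ge0 ?mulr_ge0//.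
by apply: sumr_ge0 => i _; rewrite addr_ge0 ?mulr_ge0// ltW.
Qed.

Lemma qout_le M x : (forall i x, mu i x <= M) ->
  qout lam mu x <= \sum_(i < N) (lam i + M).
Proof.
move=> mu_le; apply: ler_sum => i _; rewrite lerD2l.
by case: (0 < x i)%N; rewrite ?mul1r// mul0r (le_trans _ (mu_le i x)).
Qed.

Lemma jump_ge0 x y : 0 <= jump lam mu x y.
Proof.
rewrite /jump divr_ge0 ?(ltW (qout_gt0 _))//.
by apply: sumr_ge0 => i _; rewrite addr_ge0 ?mulr_ge0// ltW.
Qed.

Lemma jump_stochastic x : \sum_(y <- neighbours x) jump lam mu x y = 1.
Proof.
under eq_bigr do rewrite -[jump _ _ _ _]mulr1.
rewrite sum_jump; under eq_bigr do rewrite !mulr1.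
by rewrite mulfV// gt_eqF// qout_gt0.
Qed.

(* The increments [A ^+ minn k K * rho ^+ k] are chosen so that consecutive
   ratios dominate [mu i x / lam i]: the ratio is [A * rho] below level [K]
   and [rho < 1] above it. *)
Definition lyapunov (A rho : R) (K k : nat) : R :=
  A ^+ K / (1 - rho) - \sum_(j < k) A ^+ minn j K * rho ^+ j.

Lemma geometric_sum_le (rho : R) n : 0 <= rho < 1 ->
  \sum_(k < n) rho ^+ k <= (1 - rho)^-1.
Proof.
move=> /andP[rho_ge0 rho_lt1]; have rho'_gt0 : 0 < 1 - rho by rewrite subr_gt0.
rewrite -[leRHS]mul1r ler_pdivlMr// mulrC -opprB mulNr -subrX1 opprB.
by rewrite gerBl exprn_ge0.
Qed.

(** The subtracted increments are dominated by a geometric series scaled by [A ^+ K], whose sum is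
    the leading constant. *)
Lemma lyapunov_ge0 A rho K k : 1 <= A -> 0 <= rho < 1 -> 0 <= lyapunov A rho K k.
Proof.
move=> A_ge1 rho01; rewrite subr_ge0.
apply: (@le_trans _ _ (A ^+ K * \sum_(j < k) rho ^+ j)); last first.
  by rewrite ler_wpM2l ?geometric_sum_le// exprn_ge0// (le_trans ler01).
rewrite mulr_sumr; apply: ler_sum => j _; rewrite ler_wpM2r ?exprn_ge0//.
  by case/andP: rho01.
by rewrite ler_weXn2l// geq_minr.
Qed.

Lemma lyapunovS A rho K k :
  lyapunov A rho K k.+1 = lyapunov A rho K k - A ^+ minn k K * rho ^+ k.
Proof. by rewrite /lyapunov big_ord_recr /= opprD addrA. Qed.

(** Only jumps of queue [i] change the function. From level [k.+1] an arrival lowers it by the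
    increment at [k.+1] and a departure raises it by the increment at [k], so the drift is
    nonpositive once the ratio of the two is at least [mu i x / lam i]. At level 0 there are only
    arrivals, each lowering it by 1. *)
Lemma lyapunov_drift (A rho r M Q : R) (K : nat) (i : 'I_N) (x : state N) :
  1 <= A -> 0 <= rho -> M <= lam i * (A * rho) -> r <= lam i * rho ->
  qout lam mu x <= Q -> mu i x <= M -> ((K <= x i)%N -> mu i x <= r) ->
  \sum_(y <- neighbours x) jump lam mu x y * lyapunov A rho K (y i) <=
  lyapunov A rho K (x i) - lam i / Q * (x i == 0)%:R.
Proof.
move=> A_ge1 rho_ge0 M_le r_le Q_ge mu_le mu_le_far; have Q_gt0 := qout_gt0 x.
have A_ge0 : 0 <= A by rewrite (le_trans ler01).
rewrite -lerBlDl -{1}[lyapunov _ _ _ (x i)]mul1r -{1}(jump_stochastic x) mulr_suml.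
rewrite -sumrB; under eq_bigr do rewrite -mulrBr.
rewrite (sum_jump x (fun y => lyapunov A rho K (y i) - lyapunov A rho K (x i))).
rewrite (bigD1 i)//= big1 ?addr0 => [|j ji]; last first.
  rewrite /incr /decr !ffunE eq_sym (negPf ji) addn0 subn0.
  by rewrite !subrr !mulr0 addr0.
rewrite /incr /decr !ffunE eqxx addn1 subn1 ler_pdivrMr//.
have fS k : lyapunov A rho K k.+1 - lyapunov A rho K k =
    - (A ^+ minn k K * rho ^+ k) by rewrite lyapunovS addrC addKr.
case xi : (x i) => [|k] /=.
  rewrite fS min0n !expr0 !mul0r addr0 mulrN mulNr lerN2 !mulr1.
  by rewrite -mulrA ler_piMr ?(ltW (lam_gt0 _))// mulrC ler_pdivrMr ?mul1r// (lt_le_trans Q_gt0).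
rewrite mulr0 oppr0 mul0r mul1r fS -(opprB (lyapunov _ _ _ k.+1)) fS.
rewrite opprK mulrN addrC subr_le0 -xi; set D := _ * rho ^+ k.
have D_ge0 : 0 <= D by rewrite mulr_ge0 ?exprn_ge0.
(* From [K] on, the ratio of increments is at least [rho]; strictly below [K] it equals
   [A * rho]. *)
have [Kx|xK] := leqP K (x i).
  apply: (@le_trans _ _ (lam i * rho * D)).
    by rewrite ler_wpM2r// (le_trans _ r_le)// mu_le_far.
  rewrite -mulrA ler_wpM2l ?(ltW (lam_gt0 _))// xi exprS [leRHS]mulrCA ler_wpM2l//.
  rewrite /D ler_wpM2r ?exprn_ge0// ler_weXn2l//.
  exact: geq_minr.
apply: (@le_trans _ _ (lam i * (A * rho) * D)).
  by rewrite ler_wpM2r// (le_trans mu_le).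
rewrite -mulrA ler_wpM2l ?(ltW (lam_gt0 _))// xi /D.
rewrite xi in xK; rewrite (minn_idPl (ltnW (ltnW xK))).
by rewrite !exprS mulrACA.
Qed.
End QueueJump.

(** * Probabilities of path events with constrained holding times *)

Section HoldingTimes.
Context {R : realType} {N : nat} {d : measure_display} {T : measurableType d}
  (P : probability T R) (lam : 'I_N -> R) (mu : 'I_N -> state N -> R)
  (x0 : state N) (Y : T -> nat -> state N) (S : T -> nat -> R).
Hypotheses (N_gt0 : (0 < N)%N) (lam_gt0 : forall i, 0 < lam i)
  (mu_ge0 : forall i x, 0 <= mu i x) (ctmc : is_queue_ctmc P lam mu x0 Y S).

Definition short_cyl (m j n : nat) (ys : nat -> state N) (ss : nat -> R) : set T :=
  [set w | forall k, (k <= n)%N -> Y w k = ys k /\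
    (if (m <= k < j)%N then (0 < S w k) && (S w k <= 1) else ss k < S w k)].

(* Inclusion-exclusion, one holding time at a time: [0 < S k <= 1] is the
   difference of [0 < S k] and [1 < S k]. *)
Lemma short_cyl_prob (m j n : nat) ys (ss : nat -> R) : (m <= j)%N -> (j <= n.+1)%N ->
  (forall k, 0 <= ss k) ->
  measurable (short_cyl m j n ys ss) /\
  P (short_cyl m j n ys ss) =
    ((ys 0%N == x0)%:R * (\prod_(k < n) jump lam mu (ys k) (ys k.+1)) *
     \prod_(k < n.+1) (if (m <= k < j)%N then 1 - expR (- qout lam mu (ys k))
                       else expR (- (qout lam mu (ys k) * ss k))))%:E.
Proof.
move=> mj; rewrite -(subnKC mj); elim: (j - m)%N ss => [|i IHi] ss jn ss_ge0.
  have noflag k : (m <= k < m + 0)%N = false.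
    by rewrite addn0; case: leqP => //= mk; rewrite ltnNge mk.
  under [\prod_(k < n.+1) _]eq_bigr do rewrite noflag.
  suff -> : short_cyl m (m + 0) n ys ss = cyl Y S n ys ss by exact: ctmc.
  by apply/seteqP; split => w Hw k kn; have := Hw k kn; rewrite noflag.
rewrite addnS in jn *; set J := (m + i)%N in IHi jn *.
(* Thresholds 0 and 1 at index [J]: the induction hypothesis, valid for all thresholds, applies to
   both, and the difference makes [J] short. *)
pose upd (c : R) (k : nat) : R := if k == J then c else ss k.
have upd_ge0 c : 0 <= c -> forall k, 0 <= upd c k.
  by move=> c_ge0 k; rewrite /upd; case: ifP.
have [M0 P0] := IHi (upd 0) (ltnW jn) (upd_ge0 0 (lexx 0)).
have [M1 P1] := IHi (upd 1) (ltnW jn) (upd_ge0 1 ler01).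
have flagJ : (m <= J < J)%N = false by rewrite ltnn andbF.
have flagJS : (m <= J < J.+1)%N by rewrite leq_addr ltnSn.
have flagS k : k != J -> (m <= k < J.+1)%N = (m <= k < J)%N.
  by move=> kJ; rewrite ltnS [in RHS]ltn_neqAle kJ.
have sub10 : short_cyl m J n ys (upd 1) `<=` short_cyl m J n ys (upd 0).
  move=> w Hw k kn; have [-> Sk] := Hw k kn; split => //.
  move: Sk; case: ifP => // _; rewrite /upd; case: eqP => // _.
  exact: lt_trans.
have shortE : short_cyl m J.+1 n ys ss =
    short_cyl m J n ys (upd 0) `\` short_cyl m J n ys (upd 1).
  apply/seteqP; split => [w Hw|w [Hw0 Hw1] k kn].
    split=> [k kn|/(_ J jn)[_]]; last first.
      have [_] := Hw J jn; rewrite flagJS flagJ /upd eqxx => /andP[_ SJ1].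
      by rewrite ltNge SJ1.
    have [-> Sk] := Hw k kn; split => //; rewrite /upd.
    case: eqVneq Sk => [->|kJ]; last by rewrite flagS.
    by rewrite flagJS flagJ => /andP[].
  have [Yk Sk] := Hw0 k kn; split => //; move: Sk; rewrite /upd.
  case: eqVneq => [->|kJ]; last by rewrite flagS.
  rewrite flagJS flagJ => SJ0; rewrite SJ0 leNgt; apply/negP => SJ1.
  apply: Hw1 => k' kn'; have [-> Sk'] := Hw0 k' kn'; split => //.
  by move: Sk'; rewrite /upd; case: eqVneq => // ->; rewrite flagJ.
rewrite shortE; split; first exact: measurableD.
transitivity
    (P (short_cyl m J n ys (upd 0%R)) - P (short_cyl m J n ys (upd 1%R)))%E.
  rewrite measureD ?setIidr//.
  by rewrite (le_lt_trans (probability_le1 _ _))// ltry.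
rewrite P0 P1 -EFinB -mulrBr. congr (_ * _)%:E.
pose J' : 'I_n.+1 := Ordinal jn.
have prodJ (F : 'I_n.+1 -> R) :
    \prod_(k < n.+1) F k = F J' * \prod_(k < n.+1 | k != J') F k.
  exact: bigD1.
rewrite !prodJ /= flagJS flagJ /upd eqxx mulr0 oppr0 expR0 mulr1.
rewrite mulrBl; congr (_ * _ - _ * _); apply: eq_bigr => k kJ.
all: have kJn : (k : nat) != J by [].
all: by rewrite flagS// (negPf kJn).
Qed.

(* With [m = n.+1] no holding time is constrained to be short: the event is that
   the first [n] jumps follow a path of the tree with positive holding times. *)
Definition short_paths (m n : nat) (Q : pred (seq (state N))) : set T :=
  \big[setU/set0]_(l <- paths neighbours x0 n | Q l)
    short_cyl m n.+1 n (nth x0 l) (fun=> 0).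

Lemma short_pathsP m n (Q : pred (seq (state N))) w :
  short_paths m n Q w <-> exists l, [/\ l \in paths neighbours x0 n, Q l &
    short_cyl m n.+1 n (nth x0 l) (fun=> 0) w].
Proof.
rewrite /short_paths -bigcup_seq_cond; split.
  by case=> l /= /andP[ln Ql] wl; exists l.
by case=> l [ln Ql wl]; exists l => //=; rewrite ln.
Qed.

(** The states visited determine the path, so distinct paths give disjoint events and the
    probabilities add up; a threshold 0 contributes the factor 1. *)
Lemma short_paths_prob m n (Q : pred (seq (state N))) : (m <= n.+1)%N ->
  measurable (short_paths m n Q) /\
  P (short_paths m n Q) =
    (\sum_(l <- paths neighbours x0 n | Q l)
       path_weight (jump lam mu) x0 n l *
       \prod_(k < n.+1) (if (m <= k)%N then 1 - expR (- qout lam mu (nth x0 l k))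
                         else 1))%:E.
Proof.
move=> mn; set s := [seq l <- paths neighbours x0 n | Q l].
have sE : short_paths m n Q =
    \bigcup_(l in [set` s]) short_cyl m n.+1 n (nth x0 l) (fun=> 0).
  by rewrite bigcup_seq big_filter.
have cylM l := (short_cyl_prob (nth x0 l) mn (leqnn _) (fun=> lexx 0)).1.
have cylP l := (short_cyl_prob (nth x0 l) mn (leqnn _) (fun=> lexx 0)).2.
have s_uniq : uniq s by rewrite filter_uniq// uniq_paths// => x; exact: neighbours_uniq.
split.
  by rewrite sE; apply: fin_bigcup_measurable => [|l _]; [exact: finite_seq|exact: cylM].
rewrite sE measure_fin_bigcup; first last.
- by move=> l _; exact: cylM.
- move=> l l' /=; rewrite !mem_filter => /andP[_ ln] /andP[_ l'n] [w [wl wl']].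
  apply: (@eq_from_nth _ x0); rewrite (size_paths ln) ?(size_paths l'n)// => k.
  by rewrite ltnS => kn; rewrite -(wl k kn).1 (wl' k kn).1.
- exact: finite_seq.
rewrite -fsbig_seq// -[in RHS]big_filter -/s -sumEFin; apply: eq_big_seq => l.
rewrite mem_filter => /andP[_ ln].
rewrite [LHS]cylP (nth0_paths ln) eqxx mul1r; congr (_ * _)%:E.
by apply: eq_bigr => k _; rewrite ltn_ord andbT mulr0 oppr0 expR0.
Qed.

(** The path weights sum to 1 because the jump kernel is stochastic on [neighbours], so the event
    has full mass. *)
Lemma ae_path n : {ae P, forall w, short_paths n.+1 n predT w}.
Proof.
have [M PE] := short_paths_prob predT (leqnn n.+1).
exists (~` short_paths n.+1 n predT); split => //; first exact: measurableC.
rewrite probability_setC// PE -EFinB; congr _%:E; apply/eqP; rewrite subr_eq0.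
rewrite eq_sym; apply/eqP.
rewrite -[RHS](@path_mean1 _ _ neighbours (jump lam mu) x0 n); last first.
  by move=> x; exact: jump_stochastic.
apply: eq_bigr => l _; congr (_ * _); rewrite big1// => k _.
by rewrite leqNgt ltn_ord.
Qed.

(** Along every path each of the [n.+1 - m] short holding times contributes a factor at most
    [1 - expR (- Q)]; the weights then sum to 1. *)
Lemma short_run_prob_le Q m n : (forall x, qout lam mu x <= Q) ->
  (m <= n.+1)%N ->
  (P (short_paths m n predT) <= ((1 - expR (- Q)) ^+ (n.+1 - m))%:E)%E.
Proof.
move=> qout_le_Q mn; rewrite (short_paths_prob predT mn).2 lee_fin.
set r := 1 - expR (- Q).
apply: (@le_trans _ _ (path_mean neighbours (jump lam mu) x0 n
                         (fun=> r ^+ (n.+1 - m)))); last first.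
  rewrite /path_mean -mulr_suml.
  under eq_bigr do rewrite -[path_weight _ _ _ _]mulr1.
  rewrite -/(path_mean neighbours (jump lam mu) x0 n (fun=> 1)).
  by rewrite path_mean1 ?mul1r// => x; exact: jump_stochastic.
apply: ler_sum => l _; rewrite ler_wpM2l//.
  by apply: path_weight_ge0 => x y; exact: jump_ge0.
rewrite -prodr_const_nat big_geq_mkord [leRHS]big_mkcond /=.
apply: ler_prod => k _; case: ifP => _; last by rewrite ler01 lexx.
apply/andP; split.
  by rewrite subr_ge0 -[leRHS]expR0 ler_expR oppr_le0 ltW// qout_gt0.
by rewrite lerD2l lerN2 ler_expR lerN2.
Qed.

(** * Almost sure consequences by Borel-Cantelli *)

Lemma ae_eventually_not (F : nat -> set T) (B : R) :
  (forall n, measurable (F n)) ->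
  (forall n, (\sum_(k < n) P (F k) <= B%:E)%E) ->
  {ae P, forall w, exists n, forall k, (n <= k)%N -> ~ F k w}.
Proof.
move=> F_meas sum_le; exists (lim_sup_set F); split.
- by apply: bigcapT_measurable => n; apply: bigcup_measurable.
- apply: lim_sup_set_cvg0 => //; apply: (@le_lt_trans _ _ B%:E); last exact: ltry.
  apply: lime_le; first by apply: is_cvg_nneseries.
  by apply: nearW => n; rewrite big_mkord.
- move=> w /= notF n _; apply: contrapT => noF; apply: notF; exists n => k nk Fk.
  by apply: noF; exists k.
Qed.

Lemma ae_long_holding Q m : (forall x, qout lam mu x <= Q) ->
  {ae P, forall w, exists2 k, (m <= k)%N & 1 < S w k}.
Proof.
move=> qout_le_Q; set r := 1 - expR (- Q).
have r01 : 0 <= r < 1.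
  rewrite gtrBl expR_gt0 subr_ge0 -[leRHS]expR0 ler_expR oppr_le0 andbT.
  exact: le_trans (ltW (qout_gt0 N_gt0 lam_gt0 mu_ge0 x0)) _.
have ae_path' : {ae P, forall w, forall n, short_paths n.+1 n predT w}.
  by apply: ae_foralln => n; exact: ae_path.
have mn n : (m <= (m + n).+1)%N by rewrite -addnS leq_addr.
have : {ae P, forall w, exists n0, forall n, (n0 <= n)%N ->
    ~ short_paths m (m + n) predT w}.
  apply: (@ae_eventually_not (fun n => short_paths m (m + n) predT) (1 - r)^-1) => n.
  - by have [] := short_paths_prob predT (mn n).
  - apply: (@le_trans _ _ (\sum_(k < n) (r ^+ k)%:E)%E).
      apply: lee_sum => k _; apply: le_trans (short_run_prob_le qout_le_Q (mn k)) _.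
      rewrite lee_fin -addnS addKn; case/andP: r01 => r_ge0 /ltW r_le1.
      exact: ler_wiXn2l.
    by rewrite sumEFin lee_fin geometric_sum_le.
move: ae_path'; apply: filterS2 => w wpath [n0 /(_ n0 (leqnn _))].
(* With no holding time above 1 from [m] on, the path followed by [w] would witness the short run
   just excluded. *)
apply: contra_notP => no_long; have := wpath (m + n0)%N.
move=> /short_pathsP[l [ln _ wl]]; apply/short_pathsP; exists l; split => // k kn.
have [Yk] := wl k kn; have -> : (m + n0 < k)%N = false by rewrite ltnNge kn.
move=> /= Sk; split => //; rewrite Sk ltnS kn andbT.
case: leqP => // mk; rewrite leNgt; apply/negP => Sk1; apply: no_long.
by exists k.
Qed.

Lemma ae_occupation (Q A rho r M : R) (K : nat) (i : 'I_N) :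
  (forall x, qout lam mu x <= Q) -> (forall x, mu i x <= M) ->
  (forall x : state N, (K <= x i)%N -> mu i x <= r) ->
  1 <= A -> 0 <= rho < 1 -> M <= lam i * (A * rho) -> r <= lam i * rho ->
  {ae P, forall w, exists n, forall k, (n <= k)%N -> (0 < Y w k i)%N}.
Proof.
move=> qout_le_Q mu_le mu_le_far A_ge1 rho01 M_le r_le.
have Q_gt0 : 0 < Q := lt_le_trans (qout_gt0 N_gt0 lam_gt0 mu_ge0 x0) (qout_le_Q x0).
(* [F n]: queue [i] is empty after [n] jumps along a path of the tree. Its probability is the mean
   of an indicator, which [occupation_bound] sums. *)
pose F n := short_paths n.+1 n (fun l => nth x0 l n i == 0%N).
pose c := lam i / Q; have c_gt0 : 0 < c by rewrite divr_gt0.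
have PF n : P (F n) = (path_mean neighbours (jump lam mu) x0 n
    (fun x => (x i == 0%N)%:R))%:E.
  rewrite (short_paths_prob _ (leqnn _)).2 /path_mean big_mkcond; congr _%:E.
  apply: eq_bigr => l _; case: ifP => _; last by rewrite mulr0.
  by rewrite big1 // => k _; rewrite leqNgt ltn_ord.
have : {ae P, forall w, exists n0, forall n, (n0 <= n)%N -> ~ F n w}.
  apply: (@ae_eventually_not F (c^-1 * lyapunov A rho K (x0 i))) => n.
    by have [] := short_paths_prob (fun l => nth x0 l n i == 0%N) (leqnn n.+1).
  under eq_bigr do rewrite PF.
  rewrite sumEFin lee_fin mulrC ler_pdivlMr// mulrC.
  apply: (@occupation_bound _ _ neighbours (jump lam mu) x0
    (fun x => lyapunov A rho K (x i))) => [x y|x|x].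
  - exact: jump_ge0.
  - exact: lyapunov_ge0.
  - have /andP[rho_ge0 _] := rho01.
    exact: (lyapunov_drift N_gt0 lam_gt0 mu_ge0 A_ge1 rho_ge0 M_le r_le
      (qout_le_Q x) (mu_le x) (mu_le_far x)).
have ae_path' : {ae P, forall w, forall n, short_paths n.+1 n predT w}.
  by apply: ae_foralln => n; exact: ae_path.
move: ae_path'; apply: filterS2 => w wpath [n0 notF]; exists n0 => n n0n.
rewrite lt0n; apply/negP => Yn0; apply: (notF n n0n).
have /short_pathsP[l [ln _ wl]] := wpath n.
by apply/short_pathsP; exists l; split => //; rewrite -(wl n (leqnn n)).1.
Qed.

Lemma ae_holding_gt0 : {ae P, forall w, forall k, 0 < S w k}.
Proof.
apply: ae_foralln => n; have := ae_path n; apply: filterS => w.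
move=> /short_pathsP[l [_ _ /(_ n (leqnn n))[_]]].
by rewrite [(n < n)%N]ltnn.
Qed.
End HoldingTimes.

(** * From the jump sequence to continuous time *)

Lemma jtime_unbounded (R : realType) (s : nat -> R) :
  (forall k, 0 < s k) -> (forall m, exists2 k, (m <= k)%N & 1 < s k) ->
  forall t, exists n, t < jtime s n.
Proof.
move=> s_gt0 s_long.
have jtimeS n : jtime s n.+1 = jtime s n + s n by rewrite /jtime big_ord_recr.
have jtime_mono m n : (m <= n)%N -> jtime s m <= jtime s n.
  move=> /subnKC <-; elim: (n - m)%N => [|k IHk]; first by rewrite addn0.
  by rewrite addnS jtimeS (le_trans IHk)// lerDl ltW.
(* Each further holding time above 1 raises the jump time by at least 1. *)
have reach j : exists n, j%:R <= jtime s n.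
  elim: j => [|j [n IHn]]; first by exists 0%N; rewrite /jtime big_ord0.
  have [k nk sk] := s_long n; exists k.+1.
  rewrite jtimeS -natr1 lerD//; last exact: ltW.
  exact: le_trans IHn (jtime_mono _ _ nk).
move=> t; have [n tn] := reach (Num.bound `|t|); exists n.
by apply: lt_le_trans tn; rewrite (le_lt_trans (ler_norm t))// archi_boundP.
Qed.

Lemma eventually_saturatedP (R : realType) (N : nat) (y : nat -> state N)
    (s : nat -> R) : (forall t, exists n, t < jtime s n) ->
  (forall i, exists n, forall k, (n <= k)%N -> (0 < y k i)%N) ->
  eventually_saturated y s.
Proof.
move=> unbounded /choice[n0 y_gt0]; pose n1 := \max_(i < N) n0 i.
(* This sum dominates every [jtime s k] with [k <= n1], whatever the signs of the holding times. *)
exists (\sum_(k < n1.+1) `|jtime s k|) => t t_ge.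
(* The least jump time exceeding [t] has index [n.+1], so the state at [t] is [y n]; index 0 is
   impossible since [jtime s 0] is 0. *)
have [[|n] [tn n_min]] : exists n, t < jtime s n /\
    forall m, t < jtime s m -> (n <= m)%N.
  have [n tn n_min] := ex_minnP (unbounded t).
  by exists n; split.
- have : 0 <= t by apply: le_trans t_ge; apply: sumr_ge0.
  by rewrite leNgt => /negP; move: tn; rewrite /jtime big_ord0.
exists (y n); split.
  exists n; split=> //; rewrite leNgt; apply/negP => /n_min.
  by rewrite ltnn.
move=> i; apply: y_gt0; apply: leq_trans (leq_bigmax i) _; rewrite -/n1.
rewrite leqNgt; apply/negP => n_lt; move: tn; rewrite ltNge => /negP; apply.
apply: le_trans t_ge; apply: le_trans (ler_norm _) _.
by rewrite (bigD1 (Ordinal (n_lt : (n.+1 < n1.+1)%N)))//= lerDl sumr_ge0.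
Qed.

(** * The limsup hypothesis, made uniform over the queues *)

Lemma limn_esup_lt (R : realType) (u : nat -> \bar R) (a : R) :
  (limn_esup u < a%:E)%E ->
  exists2 r : R, r < a & exists K, forall n, (K <= n)%N -> (u n <= r%:E)%E.
Proof.
move=> /ereal_inf_lt[_ [V [K _ KV] <-]] sup_lt.
have u_le n : (K <= n)%N -> (u n <= ereal_sup [set u x | x in V])%E.
  by move=> Kn; apply: ereal_sup_ubound; exists n => //; exact: KV.
case: (ereal_sup _) sup_lt u_le => [r| |] //= r_lt u_le.
  by exists r => //; exists K.
(* Here the supremum is minus infinity, so any real below [a] serves. *)
exists (a - 1); first by rewrite gtrBl.
by exists K => n /u_le; rewrite leeNy_eq => /eqP ->; rewrite leNye.
Qed.

(** Transposing [i] and [j] carries the bound from queue [i] to queue [j], with the same [r] and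
    [K]. *)
Lemma far_rate_lt (R : realType) (N : nat) (lam : 'I_N -> R)
    (mu : 'I_N -> state N -> R) (i : 'I_N) :
  (forall i j, lam i = lam j) ->
  (forall (pi : 'S_N) i x, mu (pi i) (permst pi x) = mu i x) ->
  (limn_esup (fun n : nat =>
     ereal_sup [set (mu i x)%:E | x in [set x : state N | x i = n]])
   < (lam i)%:E)%E ->
  exists2 r : R, r < lam i & exists K, forall j (x : state N),
    (K <= x j)%N -> mu j x <= r.
Proof.
move=> lam_eq mu_sym /limn_esup_lt[r r_lt [K far]]; exists r => //.
exists K => j x Kx; rewrite -(mu_sym (tperm i j)) tpermR -lee_fin.
apply: le_trans (far _ Kx); apply: ereal_sup_ubound.
by exists (permst (tperm i j) x) => //=; rewrite ffunE tpermV tpermL.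
Qed.

Theorem theorem1 (R : realType) (N : nat) (d : measure_display)
    (T : measurableType d) (P : probability T R)
    (lam : 'I_N -> R) (mu : 'I_N -> state N -> R)
    (x0 : state N) (Y : T -> nat -> state N) (S : T -> nat -> R) :
  (2 <= N)%N ->
  (forall i, 0 < lam i) ->
  (forall i j, lam i = lam j) ->
  (forall i x, 0 <= mu i x) ->
  (exists M : R, forall i x, mu i x <= M) ->
  (forall (pi : 'S_N) (i : 'I_N) (x : state N), mu (pi i) (permst pi x) = mu i x) ->
  (exists i : 'I_N,
      limn_esup (fun n : nat =>
        ereal_sup [set (mu i x)%:E | x in [set x : state N | x i = n]])
      < (lam i)%:E)%E ->
  is_queue_ctmc P lam mu x0 Y S ->
  {ae P, forall w, eventually_saturated (Y w) (S w)}.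
Proof.
move=> N_ge2 lam_gt0 lam_eq mu_ge0 [M mu_le] mu_sym [i limsup_lt] ctmc.
have N_gt0 : (0 < N)%N := ltnW N_ge2.
have [r r_lt [K far]] := far_rate_lt lam_eq mu_sym limsup_lt.
have qout_bound x : qout lam mu x <= \sum_(j < N) (lam j + M) by exact: qout_le.
(* The floor 1/2 keeps [rho] positive even when [r] is not, so that [A] below can divide by it. *)
pose rho := Num.max (r / lam i) 2^-1.
have rho_gt0 : 0 < rho by rewrite lt_max invr_gt0 ltr0n orbT.
have rho_lt1 : rho < 1.
  by rewrite gt_max ltr_pdivrMr// mul1r r_lt invf_lt1// ltr1n.
have rho01 : 0 <= rho < 1 by rewrite (ltW rho_gt0).
pose A := Num.max 1 (M / (lam i * rho)).
have A_ge1 : 1 <= A by rewrite le_max lexx.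
have lamrho_gt0 : 0 < lam i * rho by rewrite mulr_gt0.
have M_le j : M <= lam j * (A * rho).
  by rewrite (lam_eq j i) mulrCA mulrC -ler_pdivrMl// mulrC le_max lexx orbT.
have r_le j : r <= lam j * rho.
  by rewrite (lam_eq j i) -ler_pdivrMl// mulrC le_max lexx.
have ae_visits : {ae P, forall w, forall j, exists n, forall k, (n <= k)%N ->
    (0 < Y w k j)%N}.
  (* Queues are indexed by natural numbers for the countable intersection; indices from [N] on are
     vacuous. *)
  have ae_j n : {ae P, forall w, forall j : 'I_N, j = n :> nat ->
      exists n, forall k, (n <= k)%N -> (0 < Y w k j)%N}.
    have [nN|nN] := ltnP n N; last first.
      by apply: aeW => w j jn; move: nN; rewrite -jn leqNgt ltn_ord.
    have := @ae_occupation _ _ _ _ _ _ _ _ _ _ N_gt0 lam_gt0 mu_ge0 ctmc _ _ _ _ _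
      K (Ordinal nN) qout_bound (mu_le _) (far _) A_ge1 rho01 (M_le _) (r_le _).
    apply: filterS => w wn j jn.
    by have -> : j = Ordinal nN by exact: val_inj.
  have := ae_foralln ae_j; apply: filterS => w wj j; exact: wj j erefl.
have ae_long : {ae P, forall w, forall m, exists2 k, (m <= k)%N & 1 < S w k}.
  apply: ae_foralln => m.
  exact: (ae_long_holding N_gt0 lam_gt0 mu_ge0 ctmc m qout_bound).
have ae_pos := ae_holding_gt0 N_gt0 lam_gt0 mu_ge0 ctmc.
move: ae_visits ae_long ae_pos; apply: filterS3 => w visits long pos.
by apply: eventually_saturatedP => //; exact: jtime_unbounded.
Qed.
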